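(* Let $(!, \delta, \varepsilon, \partial)$ be a Cartesian differential comonad on a category $\mathbb{X}$ with finite biproducts. If a $\mathsf{D}$-linear unit on $(!, \delta, \varepsilon, \partial)$ exists, then it is unique.
   Context: Composition is in classical order: $g \circ f$ means first $f$, then $g$. In a category with finite biproducts, hom-sets are commutative monoids, $\pi_0,\pi_1$ are the projections of $A\times B$, $\langle f,g\rangle$ is pairing, $h\times k=\langle h\circ\pi_0,k\circ\pi_1\rangle$. Define $\iota_0=\langle 1_A,0\rangle: A\to A\times B$, $\iota_1=\langle 0,1_B\rangle: B\to A\times B$, $\nabla_A=\pi_0+\pi_1: A\times A\to A$, $\ell_A=\iota_0\times\iota_1: A\times A\to (A\times A)\times(A\times A)$, $c_A=\langle\pi_0\times\pi_0,\pi_1\times\pi_1\rangle:(A\times A)\times(A\times A)\to(A\times A)\times(A\times A)$. Let $(!,\delta,\varepsilon)$ be a comonad on a category $\mathbb{X}$ with finite biproducts ($\delta_A:!(A)\to !!(A)$, $\varepsilon_A:!(A)\to A$). A differential combinator transformation is a natural transformation $\partial_A:!(A\times A)\to !(A)$ with: [dc.1] $\partial_A\circ !(\iota_0)=0$; [dc.2] $\partial_A\circ !(1_A\times\nabla_A)=\partial_A\circ(!(1_A\times\pi_0)+!(1_A\times\pi_1))$; [dc.3] $\varepsilon_A\circ\partial_A=\pi_1\circ\varepsilon_{A\times A}$; [dc.4] $\delta_A\circ\partial_A=\partial_{!(A)}\circ !(\langle !(\pi_0),\partial_A\rangle)\circ\delta_{A\times A}$; [dc.5] $\partial_A\circ\partial_{A\times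 A}\circ !(\ell_A)=\partial_A$; [dc.6] $\partial_A\circ\partial_{A\times A}\circ !(c_A)=\partial_A\circ\partial_{A\times A}$. A Cartesian differential comonad is a quadruple $(!,\delta,\varepsilon,\partial)$ consisting of such a comonad and a differential combinator transformation. A $\mathsf{D}$-linear unit on $(!,\delta,\varepsilon,\partial)$ is a natural transformation $\eta_A:A\to !(A)$ such that [du.1] $\varepsilon_A\circ\eta_A=1_A$ and [du.2] $\eta_A\circ\varepsilon_A=\partial_A\circ !(\iota_1)$, where $\iota_1: A\to A\times A$. *)

(* Defs.v *)
From Corelib Require Import ssreflect.

Set Implicit Arguments.
Unset Strict Implicit.
Unset Printing Implicit Defensive.

Declare Scope cat_scope.
Delimit Scope cat_scope with cat.
Local Open Scope cat_scope.

Record category := Category {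
  ob :> Type;
  hom : ob -> ob -> Type;
  idm : forall A : ob, hom A A;
  comp : forall A B C : ob, hom B C -> hom A B -> hom A C;
  comp1m : forall (A B : ob) (f : hom A B), comp (idm B) f = f;
  compm1 : forall (A B : ob) (f : hom A B), comp f (idm A) = f;
  compA : forall (A B C D : ob) (h : hom C D) (g : hom B C) (f : hom A B),
    comp h (comp g f) = comp (comp h g) f }.

Arguments hom {c} A B.
Arguments idm {c} A.
Arguments comp {c A B C} g f.

(* Classical order: first f, then g. *)
Notation "g ∘ f" := (comp g f) (at level 40, left associativity) : cat_scope.

Record functor (X Y : category) := Functor {
  fobj :> X -> Y;
  fmap : forall A B : X, hom A B -> hom (fobj A) (fobj B);
  fmap_id : forall A : X, fmap (idm A) = idm (fobj A);
  fmap_comp : forall (A B C : X) (g : hom B C) (f : hom A B),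
    fmap (g ∘ f) = fmap g ∘ fmap f }.

(* A zero object together with a chosen biproduct of every pair of objects.
   No enrichment is assumed: the addition of maps is derived below ([addm]). *)
Record finite_biproducts (X : category) := FiniteBiproducts {
  zob : X;
  to_zob : forall A : X, hom A zob;
  to_zob_uniq : forall (A : X) (f : hom A zob), f = to_zob A;
  from_zob : forall A : X, hom zob A;
  from_zob_uniq : forall (A : X) (f : hom zob A), f = from_zob A;
  biprod : X -> X -> X;
  proj0 : forall A B : X, hom (biprod A B) A;
  proj1 : forall A B : X, hom (biprod A B) B;
  pairing : forall C A B : X, hom C A -> hom C B -> hom C (biprod A B);
  proj0_pair : forall (C A B : X) (f : hom C A) (g : hom C B),
    proj0 A B ∘ pairing f g = f;
  proj1_pair : forall (C A B : X) (f : hom C A) (g : hom C B),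
    proj1 A B ∘ pairing f g = g;
  pair_uniq : forall (C A B : X) (h : hom C (biprod A B)),
    h = pairing (proj0 A B ∘ h) (proj1 A B ∘ h);
  inj0 : forall A B : X, hom A (biprod A B);
  inj1 : forall A B : X, hom B (biprod A B);
  copair : forall A B C : X, hom A C -> hom B C -> hom (biprod A B) C;
  copair_inj0 : forall (A B C : X) (f : hom A C) (g : hom B C),
    copair f g ∘ inj0 A B = f;
  copair_inj1 : forall (A B C : X) (f : hom A C) (g : hom B C),
    copair f g ∘ inj1 A B = g;
  copair_uniq : forall (A B C : X) (h : hom (biprod A B) C),
    h = copair (h ∘ inj0 A B) (h ∘ inj1 A B);
  proj0_inj0 : forall A B : X, proj0 A B ∘ inj0 A B = idm A;
  proj1_inj1 : forall A B : X, proj1 A B ∘ inj1 A B = idm B;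
  proj0_inj1 : forall A B : X,
    proj0 A B ∘ inj1 A B = from_zob A ∘ to_zob B;
  proj1_inj0 : forall A B : X,
    proj1 A B ∘ inj0 A B = from_zob B ∘ to_zob A }.

Record biprod_category := BiprodCategory {
  bcat :> category;
  bcat_biprod : finite_biproducts bcat }.

Section Biproducts.
Variable X : biprod_category.
Implicit Types A B C D : X.

Let bp : finite_biproducts X := bcat_biprod X.

Definition bprod A B : X := biprod bp A B.
Definition pi0 {A B} : hom (bprod A B) A := proj0 bp A B.
Definition pi1 {A B} : hom (bprod A B) B := proj1 bp A B.
Definition pairm {A B C} (f : hom C A) (g : hom C B) : hom C (bprod A B) :=
  pairing bp f g.

Definition zerom {A B} : hom A B := from_zob bp B ∘ to_zob bp A.

Definition addm {A B} (f g : hom A B) : hom A B :=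
  copair bp (idm B) (idm B) ∘ pairm f g.

Definition prodm {A B C D} (h : hom A C) (k : hom B D) :
    hom (bprod A B) (bprod C D) :=
  pairm (h ∘ pi0) (k ∘ pi1).

Definition iota0 {A B} : hom A (bprod A B) := pairm (idm A) zerom.
Definition iota1 {A B} : hom B (bprod A B) := pairm zerom (idm B).

Definition nabla A : hom (bprod A A) A := addm pi0 pi1.

Definition lift A : hom (bprod A A) (bprod (bprod A A) (bprod A A)) :=
  prodm iota0 iota1.

Definition cflip A :
    hom (bprod (bprod A A) (bprod A A)) (bprod (bprod A A) (bprod A A)) :=
  pairm (prodm pi0 pi0) (prodm pi1 pi1).

End Biproducts.

Arguments bprod {X} A B.
Arguments pi0 {X A B}.
Arguments pi1 {X A B}.
Arguments pairm {X A B C} f g.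
Arguments zerom {X A B}.
Arguments addm {X A B} f g.
Arguments prodm {X A B C D} h k.
Arguments iota0 {X A B}.
Arguments iota1 {X A B}.
Arguments nabla {X} A.
Arguments lift {X} A.
Arguments cflip {X} A.

Notation "A × B" := (bprod A B) (at level 40, left associativity) : cat_scope.
Notation "⟨ f , g ⟩" := (pairm f g) (at level 0, f, g at level 99) : cat_scope.
Notation "h ⊗ k" := (prodm h k) (at level 38, left associativity) : cat_scope.
Notation "f + g" := (addm f g) : cat_scope.
Notation "0" := zerom : cat_scope.

Section BiproductTheory.
Variable X : biprod_category.
Implicit Types A B C D : X.

Let bp : finite_biproducts X := bcat_biprod X.

Lemma pi0_pairm A B C (f : hom C A) (g : hom C B) : pi0 ∘ ⟨f, g⟩ = f.
Proof. exact: proj0_pair. Qed.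

Lemma pi1_pairm A B C (f : hom C A) (g : hom C B) : pi1 ∘ ⟨f, g⟩ = g.
Proof. exact: proj1_pair. Qed.

Lemma pairm_ext A B C (h k : hom C (A × B)) :
  pi0 ∘ h = pi0 ∘ k -> pi1 ∘ h = pi1 ∘ k -> h = k.
Proof.
rewrite /pi0 /pi1 => h0 h1.
by rewrite (pair_uniq h) (pair_uniq k) h0 h1.
Qed.

Lemma comp0m A B C (f : hom A B) : (0 : hom B C) ∘ f = 0.
Proof. by rewrite /zerom -compA (to_zob_uniq (to_zob bp B ∘ f)). Qed.

Lemma compm0 A B C (f : hom B C) : f ∘ (0 : hom A B) = 0.
Proof. by rewrite /zerom compA (from_zob_uniq (f ∘ from_zob bp B)). Qed.

Lemma inj0E A B : inj0 bp A B = iota0.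
Proof.
apply: pairm_ext; rewrite /iota0 ?pi0_pairm ?pi1_pairm.
- exact: proj0_inj0.
- exact: proj1_inj0.
Qed.

Lemma inj1E A B : inj1 bp A B = iota1.
Proof.
apply: pairm_ext; rewrite /iota1 ?pi0_pairm ?pi1_pairm.
- exact: proj0_inj1.
- exact: proj1_inj1.
Qed.

Lemma copairm_ext A B C (h k : hom (A × B) C) :
  h ∘ iota0 = k ∘ iota0 -> h ∘ iota1 = k ∘ iota1 -> h = k.
Proof.
rewrite -inj0E -inj1E => h0 h1.
by rewrite (copair_uniq h) (copair_uniq k) h0 h1.
Qed.

Lemma pairm_comp A B C D (f : hom C A) (g : hom C B) (h : hom D C) :
  ⟨f, g⟩ ∘ h = ⟨f ∘ h, g ∘ h⟩.
Proof.
by apply: pairm_ext; rewrite compA ?pi0_pairm ?pi1_pairm.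
Qed.

Lemma pairm_pi A B : ⟨pi0, pi1⟩ = idm (A × B).
Proof. by apply: pairm_ext; rewrite compm1 ?pi0_pairm ?pi1_pairm. Qed.

Lemma nablaE A : nabla A = copair bp (idm A) (idm A).
Proof. by rewrite /nabla /addm pairm_pi compm1. Qed.

Lemma addmDl A B C (f g : hom B C) (h : hom A B) :
  (f + g) ∘ h = f ∘ h + g ∘ h.
Proof. by rewrite /addm -compA pairm_comp. Qed.

Lemma addm0 A B (f : hom A B) : f + 0 = f.
Proof.
have -> : f + 0 = copair bp (idm B) (idm B) ∘ (iota0 ∘ f).
  by rewrite /iota0 pairm_comp comp1m comp0m.
by rewrite -inj0E compA copair_inj0 comp1m.
Qed.

Lemma add0m A B (f : hom A B) : 0 + f = f.
Proof.
have -> : 0 + f = copair bp (idm B) (idm B) ∘ (iota1 ∘ f).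
  by rewrite /iota1 pairm_comp comp1m comp0m.
by rewrite -inj1E compA copair_inj1 comp1m.
Qed.

Lemma addmC A B (f g : hom A B) : f + g = g + f.
Proof.
have e : pi0 + pi1 = pi1 + pi0 :> hom (B × B) B.
  by apply: copairm_ext;
     rewrite !addmDl /iota0 /iota1 ?pi0_pairm ?pi1_pairm addm0 add0m.
have := f_equal (fun u => u ∘ ⟨f, g⟩) e.
by rewrite !addmDl pi0_pairm pi1_pairm.
Qed.

Lemma addmA A B (f g h : hom A B) : f + (g + h) = f + g + h.
Proof.
have e : pi0 + (pi0 ∘ pi1 + pi1 ∘ pi1) = pi0 + pi0 ∘ pi1 + pi1 ∘ pi1
    :> hom (B × (B × B)) B.
  apply: copairm_ext; rewrite !addmDl -!compA /iota0 /iota1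
    ?pi0_pairm ?pi1_pairm ?compm0 ?compm1 ?addm0 //.
  by rewrite !add0m.
have := f_equal (fun u => u ∘ ⟨f, ⟨g, h⟩⟩) e.
by rewrite !addmDl -!compA !pi1_pairm !pi0_pairm ?pi1_pairm.
Qed.

Lemma addmDr A B C (f g : hom A B) (h : hom B C) :
  h ∘ (f + g) = h ∘ f + h ∘ g.
Proof.
have e : h ∘ (pi0 + pi1) = h ∘ pi0 + h ∘ pi1 :> hom (B × B) C.
  by apply: copairm_ext;
     rewrite -compA !addmDl -!compA /iota0 /iota1 ?pi0_pairm ?pi1_pairm
       ?addm0 ?add0m compm0 ?addm0 ?add0m.
have := f_equal (fun u => u ∘ ⟨f, g⟩) e.
by rewrite -compA !addmDl -!compA pi0_pairm pi1_pairm.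
Qed.

End BiproductTheory.

Record comonad (X : category) := Comonad {
  cofunctor :> functor X X;
  delta : forall A : X, hom (cofunctor A) (cofunctor (cofunctor A));
  epsilon : forall A : X, hom (cofunctor A) A;
  delta_natural : forall (A B : X) (f : hom A B),
    delta B ∘ fmap cofunctor f = fmap cofunctor (fmap cofunctor f) ∘ delta A;
  epsilon_natural : forall (A B : X) (f : hom A B),
    epsilon B ∘ fmap cofunctor f = f ∘ epsilon A;
  epsilon_delta : forall A : X,
    epsilon (cofunctor A) ∘ delta A = idm (cofunctor A);
  fmap_epsilon_delta : forall A : X,
    fmap cofunctor (epsilon A) ∘ delta A = idm (cofunctor A);
  delta_delta : forall A : X,
    delta (cofunctor A) ∘ delta A = fmap cofunctor (delta A) ∘ delta A }.

Arguments delta {X} c A.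
Arguments epsilon {X} c A.

Record is_differential_combinator_transformation (X : biprod_category)
    (T : comonad X) (d : forall A : X, hom (T (A × A)) (T A)) : Prop := {
  dc_natural : forall (A B : X) (f : hom A B),
    d B ∘ fmap T (f ⊗ f) = fmap T f ∘ d A;
  dc1 : forall A : X, d A ∘ fmap T iota0 = 0;
  dc2 : forall A : X,
    d A ∘ fmap T (idm A ⊗ nabla A)
    = d A ∘ (fmap T (idm A ⊗ pi0) + fmap T (idm A ⊗ pi1));
  dc3 : forall A : X, epsilon T A ∘ d A = pi1 ∘ epsilon T (A × A);
  dc4 : forall A : X,
    delta T A ∘ d A = d (T A) ∘ fmap T ⟨fmap T pi0, d A⟩ ∘ delta T (A × A);
  dc5 : forall A : X, d A ∘ d (A × A) ∘ fmap T (lift A) = d A;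
  dc6 : forall A : X,
    d A ∘ d (A × A) ∘ fmap T (cflip A) = d A ∘ d (A × A) }.

Record cartesian_differential_comonad (X : biprod_category) :=
  CartesianDifferentialComonad {
    cdc_comonad :> comonad X;
    partial : forall A : X, hom (cdc_comonad (A × A)) (cdc_comonad A);
    partialP : is_differential_combinator_transformation partial }.

Arguments partial {X} c A.

Record is_D_linear_unit (X : biprod_category)
    (T : cartesian_differential_comonad X)
    (eta : forall A : X, hom A (T A)) : Prop := {
  du_natural : forall (A B : X) (f : hom A B), eta B ∘ f = fmap T f ∘ eta A;
  du1 : forall A : X, epsilon T A ∘ eta A = idm A;
  du2 : forall A : X,
    eta A ∘ epsilon T A = partial T A ∘ fmap T (iota1 : hom A (A × A)) }.

(* Main.v *)
From Corelib Require Import ssreflect.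
Require Import Defs.

(** By [du2], the composite [eta A ∘ epsilon T A] is determined by the
    differential structure alone, so it is the same for any two units.  By
    [du1], [epsilon T A] is a split epimorphism with section [eta' A], hence
    can be cancelled on the right. *)

Theorem lemma3p9 (X : biprod_category) (T : cartesian_differential_comonad X)
    (eta eta' : forall A : X, hom A (T A)) :
  is_D_linear_unit eta -> is_D_linear_unit eta' ->
  forall A : X, eta A = eta' A.
Proof.
move=> u u' A.
rewrite -(compm1 (eta A)) -(du1 u' A) compA (du2 u).
by rewrite -(du2 u') -compA (du1 u') compm1.
Qed.
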